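(* Let $T$ be a computably enumerable first-order theory in a countable language $\mathcal{L}$. Suppose that whenever $h$ and $h'$ are consistent approximations of models of $T$, $A\subseteq\mathbb{N}$, $f:A\to\mathbb{N}$ is an embedding of $h\upharpoonright A$ into $h'$, and $a\in\mathbb{N}\setminus A$, there are a consistent approximation $h''$ of a model of $T$, an elementary embedding $f'$ from $h'$ into $h''$, and an embedding $g:A\cup\{a\}\to\mathbb{N}$ of $h\upharpoonright (A\cup\{a\})$ into $h''$ extending $f'\circ f$. Then $T$ has quantifier elimination.
   Context: First-order logic is taken to include the $0$-ary connective $\bot$ (so quantifier-free sentences exist even if $\mathcal{L}$ has no constant symbols). $\mathcal{L}_{\mathbb{N}}$ is $\mathcal{L}$ together with a fresh constant symbol for each element of $\mathbb{N}$. An \emph{approximation of a model} of $T$ is a function $h$ on $\mathbb{N}$ such that: (i) for each $n$, $h(n)$ is a finite set of formulas of $\mathcal{L}_{\mathbb{N}}$; (ii) for each formula $\phi$, $\lim_n\chi_{h(n)}(\phi)$ exists, i.e. $\phi$ belongs to cofinitely many of the sets $h(n)$ or to only finitely many of them; (iii) the set $\lim h$ of sentences $\phi$ of $\mathcal{L}_{\mathbb{N}}$ with $\lim_n\chi_{h(n)}(\phi)=1$ satisfies: if $\sigma\in T$ then $\sigma\in\lim h$; if $\lim h\vdash\phi$ then $\phi\in\lim h$; for every sentence $\phi$, $\phi\in\lim h$ or $\neg\phi\in\lim h$; if $\exists x\,\phi(x)\in\lim h$ then there is a constant $n\in\mathbb{N}$ with $\phi(n)\in\lim h$. The function $h$ is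 not required to be computable. $h$ is \emph{consistent} if $\bot\notin\lim h$. For a function $f$ and a sentence $\phi$ of $\mathcal{L}_{\mathbb{N}}$ whose constants from $\mathbb{N}$ lie in the domain of $f$, $f(\phi)$ is the result of replacing each constant $n\in\mathbb N$ in $\phi$ by $f(n)$. For $A\subseteq\mathbb{N}$, $f:A\to\mathbb{N}$ is an \emph{embedding} of $h\upharpoonright A$ into $h'$ if for every quantifier-free sentence $\phi$ whose constants from $\mathbb{N}$ lie in $A$, $\phi\in\lim h$ iff $f(\phi)\in\lim h'$. An embedding from $h$ into $h'$ is the case $A=\mathbb{N}$, and it is \emph{elementary} if the condition holds for all sentences of $\mathcal{L}_{\mathbb{N}}$. $T$ has quantifier elimination if for each formula $\phi(\vec x)$ of $\mathcal{L}$ there is a quantifier-free formula $\psi(\vec x)$ of $\mathcal{L}$ with $T\vdash\forall\vec x\,(\phi(\vec x)\leftrightarrow\psi(\vec x))$. *)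

(* Defs.v *)
From mathcomp Require Import all_boot.
From mathcomp Require Import boolp classical_sets functions cardinality filter.

Set Implicit Arguments.
Unset Strict Implicit.
Unset Printing Implicit Defensive.

Local Open Scope classical_set_scope.

(* The [pickle] functions of the two [countType]s are the numbering of the
   symbols with respect to which computable enumerability is understood. *)
Record language := Language {
  fsym : countType;
  rsym : countType;
  farity : fsym -> nat;
  rarity : rsym -> nat
}.

(* [term L C] and [formula L C] are the terms and formulas of the expansion of
   [L] by one fresh constant symbol for each element of [C]: [C := void] gives
   the language L itself, [C := nat] gives L_N.  Variables are de Bruijn
   indices, and equality is a logical symbol. *)
Inductive term (L : language) (C : countType) : Type :=
| Var of nat
| Cst of C
| App (f : fsym L) of ('I_(farity f) -> term L C).

Inductive formula (L : language) (C : countType) : Type :=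
| Bot
| Eqn of term L C & term L C
| Atom (r : rsym L) of ('I_(rarity r) -> term L C)
| And of formula L C & formula L C
| Or of formula L C & formula L C
| Imp of formula L C & formula L C
| All of formula L C
| Ex of formula L C.

Arguments Var {L C} _.
Arguments Cst {L C} _.
Arguments App {L C} f _.
Arguments Bot {L C}.
Arguments Eqn {L C} _ _.
Arguments Atom {L C} r _.

Definition Neg L C (phi : formula L C) := Imp phi Bot.
Definition Iff L C (phi psi : formula L C) := And (Imp phi psi) (Imp psi phi).
Definition Alls L C (n : nat) (phi : formula L C) := iter n (@All L C) phi.

(* Free variables: [bounded n phi] says that phi is a formula
   phi(x_0, ..., x_(n-1)). *)

Fixpoint term_bounded L C (n : nat) (t : term L C) : Prop :=
  match t with
  | Var k => k < n
  | Cst _ => True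
  | App _ ts => forall i, term_bounded n (ts i)
  end.

Fixpoint bounded L C (n : nat) (phi : formula L C) : Prop :=
  match phi with
  | Bot => True
  | Eqn s t => term_bounded n s /\ term_bounded n t
  | Atom _ ts => forall i, term_bounded n (ts i)
  | And p q | Or p q | Imp p q => bounded n p /\ bounded n q
  | All p | Ex p => bounded n.+1 p
  end.

Definition sentence L C (phi : formula L C) : Prop := bounded 0 phi.

Fixpoint quantifier_free L C (phi : formula L C) : bool :=
  match phi with
  | Bot | Eqn _ _ | Atom _ _ => true
  | And p q | Or p q | Imp p q => quantifier_free p && quantifier_free q
  | All _ | Ex _ => false
  end.

Fixpoint subst_term L C (s : nat -> term L C) (t : term L C) : term L C :=
  match t with
  | Var k => s k
  | Cst c => Cst c
  | App f ts => App f (fun i => subst_term s (ts i))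
  end.

Definition scons L C (t : term L C) (s : nat -> term L C) (k : nat) :=
  if k is k'.+1 then s k' else t.

Definition up L C (s : nat -> term L C) : nat -> term L C :=
  scons (Var 0) (fun k => subst_term (fun j => Var j.+1) (s k)).

Fixpoint subst L C (s : nat -> term L C) (phi : formula L C) : formula L C :=
  match phi with
  | Bot => Bot
  | Eqn t u => Eqn (subst_term s t) (subst_term s u)
  | Atom r ts => Atom r (fun i => subst_term s (ts i))
  | And p q => And (subst s p) (subst s q)
  | Or p q => Or (subst s p) (subst s q)
  | Imp p q => Imp (subst s p) (subst s q)
  | All p => All (subst (up s) p)
  | Ex p => Ex (subst (up s) p)
  end.

Definition shift L C (phi : formula L C) := subst (fun k => Var k.+1) phi.

(* phi(t), for the variable 0 of phi *)
Definition inst L C (phi : formula L C) (t : term L C) :=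
  subst (scons t Var) phi.

(* Classical natural deduction with equality; the context is an arbitrary,
   possibly infinite, set of formulas. *)
Inductive entails (L : language) (C : countType) :
    set (formula L C) -> formula L C -> Prop :=
| Hyp G p : G p -> entails G p
| BotC G p : entails (Neg p |` G) Bot -> entails G p
| AndI G p q : entails G p -> entails G q -> entails G (And p q)
| AndEl G p q : entails G (And p q) -> entails G p
| AndEr G p q : entails G (And p q) -> entails G q
| OrIl G p q : entails G p -> entails G (Or p q)
| OrIr G p q : entails G q -> entails G (Or p q)
| OrE G p q r : entails G (Or p q) ->
    entails (p |` G) r -> entails (q |` G) r -> entails G r
| ImpI G p q : entails (p |` G) q -> entails G (Imp p q)
| ImpE G p q : entails G (Imp p q) -> entails G p -> entails G q
| AllI G p : entails (@shift L C @` G) p -> entails G (All p)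
| AllE G p t : entails G (All p) -> entails G (inst p t)
| ExI G p t : entails G (inst p t) -> entails G (Ex p)
| ExE G p q : entails G (Ex p) ->
    entails (p |` (@shift L C @` G)) (shift q) -> entails G q
| EqnI G t : entails G (Eqn t t)
| EqnE G p t u : entails G (Eqn t u) -> entails G (inst p t) ->
    entails G (inst p u).

Fixpoint map_term L (C D : countType) (f : C -> D) (t : term L C) : term L D :=
  match t with
  | Var k => Var k
  | Cst c => Cst (f c)
  | App g ts => App g (fun i => map_term f (ts i))
  end.

Fixpoint map_formula L (C D : countType) (f : C -> D) (phi : formula L C) :
    formula L D :=
  match phi with
  | Bot => Bot
  | Eqn t u => Eqn (map_term f t) (map_term f u)
  | Atom r ts => Atom r (fun i => map_term f (ts i))
  | And p q => And (map_formula f p) (map_formula f q)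
  | Or p q => Or (map_formula f p) (map_formula f q)
  | Imp p q => Imp (map_formula f p) (map_formula f q)
  | All p => All (map_formula f p)
  | Ex p => Ex (map_formula f p)
  end.

Fixpoint term_consts_in L (C : countType) (A : set C) (t : term L C) : Prop :=
  match t with
  | Var _ => True
  | Cst c => A c
  | App _ ts => forall i, term_consts_in A (ts i)
  end.

Fixpoint consts_in L (C : countType) (A : set C) (phi : formula L C) : Prop :=
  match phi with
  | Bot => True
  | Eqn t u => term_consts_in A t /\ term_consts_in A u
  | Atom _ ts => forall i, term_consts_in A (ts i)
  | And p q | Or p q | Imp p q => consts_in A p /\ consts_in A q
  | All p | Ex p => consts_in A p
  end.

(* Kleene's mu-recursive functions. *)
Inductive murec : nat -> Type :=
| MZero n : murec n
| MSucc : murec 1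
| MProj n of 'I_n : murec n
| MComp m n of murec m & ('I_m -> murec n) : murec n
| MPrec n of murec n & murec n.+2 : murec n.+1
| MMin n of murec n.+1 : murec n.

(* [computes p x y]: the partial function with program p is defined at x, with
   value y.  Primitive recursion is on the first argument, with step
   g (i, value at i, parameters), and [MMin] searches for the first argument. *)
Fixpoint computes n (p : murec n) : n.-tuple nat -> nat -> Prop :=
  match p in murec n return n.-tuple nat -> nat -> Prop with
  | MZero _ => fun _ y => y = 0
  | MSucc => fun x y => y = (thead x).+1
  | MProj _ i => fun x y => y = tnth x i
  | MComp m _ f g => fun x y =>
      exists2 z : m.-tuple nat,
        forall i, computes (g i) x (tnth z i) & computes f z y
  | MPrec _ f g => fun x y =>
      exists s : nat -> nat,
        [/\ computes f (behead_tuple x) (s 0),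
            forall i, i < thead x ->
              computes g [tuple of i :: s i :: behead x] (s i.+1)
          & y = s (thead x)]
  | MMin _ f => fun x y =>
      computes f [tuple of y :: x] 0 /\
      forall z, z < y -> exists v, computes f [tuple of z :: x] v.+1
  end.

(* Domain of a partial recursive function. *)
Definition comp_enumerable (S : set nat) : Prop :=
  exists p : murec 1, forall n, S n <-> exists y, computes p [tuple n] y.

(* Goedel numbers *)

Fixpoint term_code L C (t : term L C) : nat :=
  match t with
  | Var k => CodeSeq.code [:: 0; k]
  | Cst c => CodeSeq.code [:: 1; pickle c]
  | App f ts => CodeSeq.code
      [:: 2, pickle f & [seq term_code (ts i) | i <- enum 'I_(farity f)]]
  end.

Fixpoint formula_code L C (phi : formula L C) : nat :=
  match phi with
  | Bot => CodeSeq.code [:: 0]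
  | Eqn t u => CodeSeq.code [:: 1; term_code t; term_code u]
  | Atom r ts => CodeSeq.code
      [:: 2, pickle r & [seq term_code (ts i) | i <- enum 'I_(rarity r)]]
  | And p q => CodeSeq.code [:: 3; formula_code p; formula_code q]
  | Or p q => CodeSeq.code [:: 4; formula_code p; formula_code q]
  | Imp p q => CodeSeq.code [:: 5; formula_code p; formula_code q]
  | All p => CodeSeq.code [:: 6; formula_code p]
  | Ex p => CodeSeq.code [:: 7; formula_code p]
  end.

Definition ce_theory L (T : set (formula L void)) : Prop :=
  comp_enumerable (@formula_code L void @` T).

(* The set of sentences lim h. *)
Definition lim_set L (h : nat -> set (formula L nat)) : set (formula L nat) :=
  [set phi | sentence phi /\ \forall n \near \oo, h n phi].

Record approximation L (T : set (formula L void))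
    (h : nat -> set (formula L nat)) : Prop := Approximation {
  approx_finite : forall n, finite_set (h n);
  approx_lim : forall phi,
    (\forall n \near \oo, h n phi) \/ (\forall n \near \oo, ~ h n phi);
  approx_theory : forall sigma, T sigma ->
    lim_set h (map_formula (of_void nat) sigma);
  approx_closed : forall phi, sentence phi ->
    entails (lim_set h) phi -> lim_set h phi;
  approx_complete : forall phi, sentence phi ->
    lim_set h phi \/ lim_set h (Neg phi);
  approx_witness : forall phi, lim_set h (Ex phi) ->
    exists n : nat, lim_set h (inst phi (Cst n))
}.

Definition consistent L (h : nat -> set (formula L nat)) : Prop :=
  ~ lim_set h Bot.

(* A function A -> N is represented by a total function, of which only the
   values on A matter. *)
Definition embedding L (h : nat -> set (formula L nat)) (A : set nat)
    (f : nat -> nat) (h' : nat -> set (formula L nat)) : Prop :=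
  forall phi, sentence phi -> quantifier_free phi -> consts_in A phi ->
    (lim_set h phi <-> lim_set h' (map_formula f phi)).

Definition elementary_embedding L (h : nat -> set (formula L nat))
    (f : nat -> nat) (h' : nat -> set (formula L nat)) : Prop :=
  forall phi, sentence phi ->
    (lim_set h phi <-> lim_set h' (map_formula f phi)).

Definition quantifier_elimination L (T : set (formula L void)) : Prop :=
  forall (n : nat) (phi : formula L void), bounded n phi ->
    exists psi : formula L void,
      [/\ bounded n psi, quantifier_free psi
        & entails T (Alls n (Iff phi psi))].

(* Main.v *)
Require Import Defs.
From mathcomp Require Import all_boot.
From mathcomp Require Import boolp classical_sets functions cardinality filter.

Local Open Scope classical_set_scope.

(** The limit set of an approximation is a complete Henkin theory whose
    witnesses are the natural numbers.  Conversely every complete consistent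
    Henkin theory H over N is a limit set: let the n-th stage consist of the
    finitely many members of H whose code is below n ([lim_setE]).  So the
    hypothesis is the usual one-point extension test for countable models, and
    the classical argument applies, with syntax in place of semantics
    throughout.

    By induction on formulas ([qf_equivalent]) it suffices to find a
    quantifier-free equivalent for phi(x) = exists y, theta(x, y) with theta
    quantifier-free.  Substitute the constants 0, ..., n-1 for the n variables
    of phi, and let X be the set of quantifier-free consequences of phi over T.
    If T and X prove phi, compactness yields one psi in X with
    T |- psi -> phi, and psi is equivalent to phi.  Otherwise T + X + not-phi
    is consistent, hence holds in some h'.  The quantifier-free sentences about
    0, ..., n-1 true in h' are then consistent with T + phi: if finitely many
    of them refuted phi, the negation of their conjunction would belong to X
    and would hold in h'.  So they hold in some h satisfying phi, and the
    identity embeds h restricted to {0, ..., n-1} into h'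
    ([qf_equivalent_or_separated]).  In h pick a witness a of phi.  Extending
    the embedding to a gives an elementary extension of h' in which theta,
    hence phi, holds of the images of 0, ..., n-1; but not-phi was inherited
    from h', a contradiction ([qf_equivalent_Ex]).

    The tools are: simultaneous translation of variables and constants, under
    which derivability is preserved ([entails_tr]), so that constants may be
    replaced by variables; compactness for directed families
    ([entails_directed]); and Henkin's construction ([model_existence]). *)

Set Implicit Arguments.
Unset Strict Implicit.
Unset Printing Implicit Defensive.

(** * Translations of variables and constants *)

Definition lift_term L C (t : term L C) : term L C :=
  subst_term (fun j => Var j.+1) t.

(** One operation replaces variables by [s] and constants by [k] at once.
    Substitution, renaming of constants and the passage between constants and
    variables are all instances of it, so their interaction reduces to the
    composition law [tr_comp]. *)
Fixpoint tr_term L (C D : countType) (s : nat -> term L D) (k : C -> term L D)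
    (t : term L C) : term L D :=
  match t with
  | Var j => s j
  | Cst c => k c
  | App f ts => App f (fun i => tr_term s k (ts i))
  end.

Fixpoint tr L (C D : countType) (s : nat -> term L D) (k : C -> term L D)
    (phi : formula L C) : formula L D :=
  match phi with
  | Bot => Bot
  | Eqn t u => Eqn (tr_term s k t) (tr_term s k u)
  | Atom r ts => Atom r (fun i => tr_term s k (ts i))
  | And p q => And (tr s k p) (tr s k q)
  | Or p q => Or (tr s k p) (tr s k q)
  | Imp p q => Imp (tr s k p) (tr s k q)
  | All p => All (tr (up s) (fun c => lift_term (k c)) p)
  | Ex p => Ex (tr (up s) (fun c => lift_term (k c)) p)
  end.

Lemma subst_termE L C (s : nat -> term L C) t :
  subst_term s t = tr_term s Cst t.
Proof.
by elim: t => //= f ts IH; congr App; apply/funext => i; apply: IH.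
Qed.

Lemma substE L C (s : nat -> term L C) p : subst s p = tr s Cst p.
Proof.
elim: p s => //=.
- by move=> t u s; rewrite !subst_termE.
- by move=> r ts s; congr Atom; apply/funext => i; rewrite subst_termE.
- by move=> p IHp q IHq s; rewrite IHp IHq.
- by move=> p IHp q IHq s; rewrite IHp IHq.
- by move=> p IHp q IHq s; rewrite IHp IHq.
- by move=> p IHp s; rewrite IHp.
- by move=> p IHp s; rewrite IHp.
Qed.

Lemma map_termE L (C D : countType) (f : C -> D) (t : term L C) :
  map_term f t = tr_term Var (fun c => Cst (f c)) t.
Proof.
by elim: t => //= g ts IH; congr App; apply/funext => i; apply: IH.
Qed.

Lemma up_Var L C : up (@Var L C) = Var.
Proof. by apply/funext => -[]. Qed.

Lemma map_formulaE L (C D : countType) (f : C -> D) (p : formula L C) :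
  map_formula f p = tr Var (fun c => Cst (f c)) p.
Proof.
elim: p => //=.
- by move=> t u; rewrite !map_termE.
- by move=> r ts; congr Atom; apply/funext => i; rewrite map_termE.
- by move=> p -> q ->.
- by move=> p -> q ->.
- by move=> p -> q ->.
- by move=> p ->; rewrite up_Var.
- by move=> p ->; rewrite up_Var.
Qed.

Lemma tr_term_comp L (C D E : countType) (s1 : nat -> term L D)
    (k1 : C -> term L D) (s2 : nat -> term L E) (k2 : D -> term L E) t :
  tr_term s2 k2 (tr_term s1 k1 t) =
  tr_term (fun j => tr_term s2 k2 (s1 j)) (fun c => tr_term s2 k2 (k1 c)) t.
Proof.
by elim: t => //= f ts IH; congr App; apply/funext => i; apply: IH.
Qed.

Lemma tr_lift_term L (C D : countType) (s : nat -> term L D)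
    (k : C -> term L D) t :
  tr_term (up s) (fun c => lift_term (k c)) (lift_term t) =
  lift_term (tr_term s k t).
Proof.
rewrite /lift_term !subst_termE !tr_term_comp.
by congr tr_term; apply/funext => c /=; rewrite /up /= subst_termE.
Qed.

Lemma tr_up L (C D : countType) (s1 : nat -> term L C)
    (s : nat -> term L D) (k : C -> term L D) :
  (fun j => tr_term (up s) (fun c => lift_term (k c)) (up s1 j)) =
  up (fun j => tr_term s k (s1 j)).
Proof. by apply/funext => -[|j] //=; apply: tr_lift_term. Qed.

Lemma tr_comp L (C D E : countType) (s1 : nat -> term L D)
    (k1 : C -> term L D) (s2 : nat -> term L E) (k2 : D -> term L E) p :
  tr s2 k2 (tr s1 k1 p) =
  tr (fun j => tr_term s2 k2 (s1 j)) (fun c => tr_term s2 k2 (k1 c)) p.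
Proof.
elim: p s1 k1 s2 k2 => //=.
- by move=> t u s1 k1 s2 k2; rewrite !tr_term_comp.
- by move=> r ts s1 k1 s2 k2; congr Atom; apply/funext => i;
    rewrite tr_term_comp.
- by move=> p IHp q IHq s1 k1 s2 k2; rewrite IHp IHq.
- by move=> p IHp q IHq s1 k1 s2 k2; rewrite IHp IHq.
- by move=> p IHp q IHq s1 k1 s2 k2; rewrite IHp IHq.
- move=> p IHp s1 k1 s2 k2; rewrite IHp tr_up.
  by under [X in tr _ X p]funext do rewrite tr_lift_term.
- move=> p IHp s1 k1 s2 k2; rewrite IHp tr_up.
  by under [X in tr _ X p]funext do rewrite tr_lift_term.
Qed.

Lemma tr_shift L (C D : countType) (s : nat -> term L D) (k : C -> term L D) p :
  tr (up s) (fun c => lift_term (k c)) (shift p) = shift (tr s k p).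
Proof.
rewrite /shift !substE !tr_comp.
by congr tr; apply/funext => c /=; rewrite /up /lift_term /= subst_termE.
Qed.

Lemma tr_inst L (C D : countType) (s : nat -> term L D) (k : C -> term L D)
    p t :
  tr s k (inst p t) =
  inst (tr (up s) (fun c => lift_term (k c)) p) (tr_term s k t).
Proof.
rewrite /inst !substE !tr_comp; congr tr; apply/funext.
- case=> [|j] //=; rewrite /up /= subst_termE tr_term_comp /=.
  elim: (s j) => //= f ts IH; congr App; apply/funext => i; apply: IH.
- move=> c /=; rewrite /lift_term subst_termE tr_term_comp /=.
  elim: (k c) => //= f ts IH; congr App; apply/funext => i; apply: IH.
Qed.

Lemma eq_tr_term L (C D : countType) (n : nat) (A : set C)
    (s s' : nat -> term L D) (k k' : C -> term L D) t :
  (forall j, j < n -> s j = s' j) -> (forall c, A c -> k c = k' c) ->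
  term_bounded n t -> term_consts_in A t -> tr_term s k t = tr_term s' k' t.
Proof.
move=> ss' kk'; elim: t => //= [j /ss' //|c _ /kk' //|f ts IH bt ct].
by congr App; apply/funext => i; apply: IH.
Qed.

(** A translation of a formula depends only on the values at its free variables
    and its constants; below it identifies translations that agree there. *)
Lemma eq_tr L (C D : countType) (n : nat) (A : set C)
    (s s' : nat -> term L D) (k k' : C -> term L D) p :
  (forall j, j < n -> s j = s' j) -> (forall c, A c -> k c = k' c) ->
  bounded n p -> consts_in A p -> tr s k p = tr s' k' p.
Proof.
have upP m (r r' : nat -> term L D) : (forall j, j < m -> r j = r' j) ->
    forall j, j < m.+1 -> up r j = up r' j.
  by move=> rr' [|j] //=; rewrite /up ltnS /= => /rr' ->.
elim: p n s s' k k' => //=.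
- move=> t u n s s' k k' ss' kk' [bt bu] [ct cu].
  by rewrite (eq_tr_term ss' kk' bt ct) (eq_tr_term ss' kk' bu cu).
- move=> r ts n s s' k k' ss' kk' bt ct; congr Atom; apply/funext => i.
  exact: (eq_tr_term ss' kk' (bt i) (ct i)).
- move=> p IHp q IHq n s s' k k' ss' kk' [bp bq] [cp cq].
  by rewrite (IHp _ _ _ _ _ ss' kk' bp cp) (IHq _ _ _ _ _ ss' kk' bq cq).
- move=> p IHp q IHq n s s' k k' ss' kk' [bp bq] [cp cq].
  by rewrite (IHp _ _ _ _ _ ss' kk' bp cp) (IHq _ _ _ _ _ ss' kk' bq cq).
- move=> p IHp q IHq n s s' k k' ss' kk' [bp bq] [cp cq].
  by rewrite (IHp _ _ _ _ _ ss' kk' bp cp) (IHq _ _ _ _ _ ss' kk' bq cq).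
- move=> p IHp n s s' k k' ss' kk' bp cp; congr All.
  by apply: (IHp _ _ _ _ _ (upP _ _ _ ss') _ bp cp) => c /kk' ->.
- move=> p IHp n s s' k k' ss' kk' bp cp; congr Ex.
  by apply: (IHp _ _ _ _ _ (upP _ _ _ ss') _ bp cp) => c /kk' ->.
Qed.

Lemma tr_term_id L C (t : term L C) : tr_term Var Cst t = t.
Proof.
by elim: t => //= f ts IH; congr App; apply/funext => i; apply: IH.
Qed.

Lemma tr_id L C (p : formula L C) : tr Var Cst p = p.
Proof.
elim: p => //=.
- by move=> t u; rewrite !tr_term_id.
- by move=> r ts; congr Atom; apply/funext => i; rewrite tr_term_id.
- by move=> p -> q ->.
- by move=> p -> q ->.
- by move=> p -> q ->.
- by move=> p IHp; rewrite up_Var IHp.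
- by move=> p IHp; rewrite up_Var IHp.
Qed.

Lemma term_bounded_tr L (C D : countType) (A : set C) (n m : nat)
    (s : nat -> term L D) (k : C -> term L D) t :
  (forall j, j < n -> term_bounded m (s j)) ->
  (forall c, A c -> term_bounded m (k c)) ->
  term_bounded n t -> term_consts_in A t -> term_bounded m (tr_term s k t).
Proof.
move=> sP kP; elim: t => //= [j /sP //|c _ /kP //|f ts IH bt ct i].
exact: IH.
Qed.

Lemma term_consts_inT L (C : countType) (t : term L C) : term_consts_in setT t.
Proof. by elim: t. Qed.

Lemma consts_inT L (C : countType) (p : formula L C) : consts_in setT p.
Proof.
by elim: p => //= [t u|r ts i]; first split; apply: term_consts_inT.
Qed.

Lemma term_bounded_lift L C m (t : term L C) :
  term_bounded m t -> term_bounded m.+1 (lift_term t).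
Proof.
rewrite /lift_term subst_termE => bt.
by apply: (term_bounded_tr (A := setT) (n := m)) => //; apply: term_consts_inT.
Qed.

Lemma bounded_tr L (C D : countType) (A : set C) (n m : nat)
    (s : nat -> term L D) (k : C -> term L D) p :
  (forall j, j < n -> term_bounded m (s j)) ->
  (forall c, A c -> term_bounded m (k c)) ->
  bounded n p -> consts_in A p -> bounded m (tr s k p).
Proof.
have upP n' m' (r : nat -> term L D) :
    (forall j, j < n' -> term_bounded m' (r j)) ->
    forall j, j < n'.+1 -> term_bounded m'.+1 (up r j).
  by move=> rP [|j] //=; rewrite ltnS => /rP; apply: term_bounded_lift.
elim: p n m s k => //=.
- move=> t u n m s k sP kP [bt bu] [ct cu].
  by split; apply: term_bounded_tr sP kP _ _.
- by move=> r ts n m s k sP kP bt ct i; apply: term_bounded_tr sP kP _ _.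
- move=> p IHp q IHq n m s k sP kP [bp bq] [cp cq].
  by split; [apply: IHp sP kP _ _|apply: IHq sP kP _ _].
- move=> p IHp q IHq n m s k sP kP [bp bq] [cp cq].
  by split; [apply: IHp sP kP _ _|apply: IHq sP kP _ _].
- move=> p IHp q IHq n m s k sP kP [bp bq] [cp cq].
  by split; [apply: IHp sP kP _ _|apply: IHq sP kP _ _].
- move=> p IHp n m s k sP kP bp cp; apply: IHp (upP _ _ _ sP) _ bp cp.
  by move=> c /kP; apply: term_bounded_lift.
- move=> p IHp n m s k sP kP bp cp; apply: IHp (upP _ _ _ sP) _ bp cp.
  by move=> c /kP; apply: term_bounded_lift.
Qed.

Lemma term_consts_in_tr L (C D : countType) (A : set C) (B : set D) (n : nat)
    (s : nat -> term L D) (k : C -> term L D) t :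
  (forall j, j < n -> term_consts_in B (s j)) ->
  (forall c, A c -> term_consts_in B (k c)) ->
  term_bounded n t -> term_consts_in A t -> term_consts_in B (tr_term s k t).
Proof.
move=> sP kP; elim: t => //= [j /sP //|c _ /kP //|f ts IH bt ct i].
exact: IH.
Qed.

Lemma term_consts_in_lift L C B (t : term L C) :
  term_consts_in B t -> term_consts_in B (lift_term t).
Proof. by rewrite /lift_term; elim: t => //= f ts IH bt i; apply: IH. Qed.

Lemma consts_in_tr L (C D : countType) (A : set C) (B : set D) (n : nat)
    (s : nat -> term L D) (k : C -> term L D) p :
  (forall j, j < n -> term_consts_in B (s j)) ->
  (forall c, A c -> term_consts_in B (k c)) ->
  bounded n p -> consts_in A p -> consts_in B (tr s k p).
Proof.
have upP n' (r : nat -> term L D) :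
    (forall j, j < n' -> term_consts_in B (r j)) ->
    forall j, j < n'.+1 -> term_consts_in B (up r j).
  by move=> rP [|j] //=; rewrite ltnS => /rP; apply: term_consts_in_lift.
elim: p n s k => //=.
- move=> t u n s k sP kP [bt bu] [ct cu].
  by split; apply: term_consts_in_tr sP kP _ _.
- by move=> r ts n s k sP kP bt ct i; apply: term_consts_in_tr sP kP _ _.
- move=> p IHp q IHq n s k sP kP [bp bq] [cp cq].
  by split; [apply: IHp sP kP _ _|apply: IHq sP kP _ _].
- move=> p IHp q IHq n s k sP kP [bp bq] [cp cq].
  by split; [apply: IHp sP kP _ _|apply: IHq sP kP _ _].
- move=> p IHp q IHq n s k sP kP [bp bq] [cp cq].
  by split; [apply: IHp sP kP _ _|apply: IHq sP kP _ _].
- move=> p IHp n s k sP kP bp cp; apply: IHp (upP _ _ sP) _ bp cp.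
  by move=> c /kP; apply: term_consts_in_lift.
- move=> p IHp n s k sP kP bp cp; apply: IHp (upP _ _ sP) _ bp cp.
  by move=> c /kP; apply: term_consts_in_lift.
Qed.

Lemma quantifier_free_tr L (C D : countType)
    (s : nat -> term L D) (k : C -> term L D) p :
  quantifier_free (tr s k p) = quantifier_free p.
Proof. by elim: p s k => //= p IHp q IHq s k; rewrite IHp IHq. Qed.

(** * Structural properties of derivability *)

(** No rule of the calculus distinguishes a constant from a variable that is
    not bound, so derivations can be translated rule by rule.  Three uses:
    substitution, passage between L and L_N, and generalization on
    constants. *)
Lemma entails_tr L (C D : countType) (s : nat -> term L D) (k : C -> term L D)
    G p :
  entails G p -> entails (tr s k @` G) (tr s k p).
Proof.
move=> Gp; elim: Gp D s k => {G p}.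
- by move=> G p Gp D s k; apply: Hyp; exists p.
- move=> G p _ IH D s k; apply: BotC.
  by have := IH D s k; rewrite image_setU image_set1.
- by move=> G p q _ IHp _ IHq D s k; apply: AndI; [apply: IHp|apply: IHq].
- by move=> G p q _ IH D s k; apply: AndEl (IH D s k).
- by move=> G p q _ IH D s k; apply: AndEr (IH D s k).
- by move=> G p q _ IH D s k; apply: OrIl (IH D s k).
- by move=> G p q _ IH D s k; apply: OrIr (IH D s k).
- move=> G p q r _ IH1 _ IH2 _ IH3 D s k.
  apply: OrE (IH1 D s k) _ _.
    by have := IH2 D s k; rewrite image_setU image_set1.
  by have := IH3 D s k; rewrite image_setU image_set1.
- move=> G p q _ IH D s k; apply: ImpI.
  by have := IH D s k; rewrite image_setU image_set1.
- by move=> G p q _ IH1 _ IH2 D s k; apply: ImpE (IH1 D s k) (IH2 D s k).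
- move=> G p _ IH D s k; apply: AllI.
  have := IH D (up s) (fun c => lift_term (k c)); rewrite !image_comp.
  by under [X in X @` G]funext do rewrite /= tr_shift.
- by move=> G p t _ IH D s k; rewrite tr_inst; apply: AllE (IH D s k).
- move=> G p t _ IH D s k; apply: (ExI (t := tr_term s k t)).
  by rewrite -tr_inst; apply: IH.
- move=> G p q _ IH1 _ IH2 D s k; apply: ExE (IH1 D s k) _.
  have := IH2 D (up s) (fun c => lift_term (k c)).
  rewrite image_setU image_set1 !image_comp tr_shift.
  by under [X in X @` G]funext do rewrite /= tr_shift.
- by move=> G t D s k; apply: EqnI.
- move=> G p t u _ IH1 _ IH2 D s k; rewrite tr_inst.
  by apply: EqnE (IH1 D s k) _; rewrite -tr_inst; apply: IH2.
Qed.

Lemma entails_weak L (C : countType) (G H : set (formula L C)) p :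
  entails G p -> G `<=` H -> entails H p.
Proof.
move=> Gp; elim: Gp H => {G p}.
- by move=> G p Gp H /(_ _ Gp); apply: Hyp.
- by move=> G p _ IH H GH; apply/BotC/IH/setUS.
- by move=> G p q _ IHp _ IHq H GH; apply: AndI; [apply: IHp|apply: IHq].
- by move=> G p q _ IH H GH; apply: AndEl (IH H GH).
- by move=> G p q _ IH H GH; apply: AndEr (IH H GH).
- by move=> G p q _ IH H GH; apply: OrIl (IH H GH).
- by move=> G p q _ IH H GH; apply: OrIr (IH H GH).
- move=> G p q r _ IH1 _ IH2 _ IH3 H GH.
  by apply: OrE (IH1 H GH) (IH2 _ _) (IH3 _ _); apply: setUS.
- by move=> G p q _ IH H GH; apply/ImpI/IH/setUS.
- by move=> G p q _ IH1 _ IH2 H GH; apply: ImpE (IH1 H GH) (IH2 H GH).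
- by move=> G p _ IH H GH; apply/AllI/IH/image_subset.
- by move=> G p t _ IH H GH; apply: AllE (IH H GH).
- by move=> G p t _ IH H GH; apply: ExI (IH H GH).
- move=> G p q _ IH1 _ IH2 H GH; apply: ExE (IH1 H GH) (IH2 _ _).
  by apply/setUS/image_subset.
- by move=> G t H _; apply: EqnI.
- by move=> G p t u _ IH1 _ IH2 H GH; apply: EqnE (IH1 H GH) (IH2 H GH).
Qed.

Definition directed (I U : Type) (F : I -> set U) : Prop :=
  forall i j, exists k, F i `<=` F k /\ F j `<=` F k.

(** Members of [G] need only be derivable from the family, not belong to it;
    this makes the cut rule a special case of compactness. *)
Definition covers L (C : countType) (I : Type) (F : I -> set (formula L C))
    (G : set (formula L C)) : Prop :=
  forall q, G q -> exists i, entails (F i) q.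

(** Compactness, in a form stable under the operations that the rules apply to
    contexts: adding a formula and shifting both preserve directedness and
    covering, so the induction on derivations needs no finite sets, only a
    common upper bound of the indices used by the premises. *)
Lemma entails_directed L (C : countType) (I : Type) (i0 : I)
    (F : I -> set (formula L C)) (G : set (formula L C)) p :
  directed F -> covers F G -> entails G p -> exists i, entails (F i) p.
Proof.
have dirU (F' : I -> set (formula L C)) r :
    directed F' -> directed (fun i : I => r |` F' i).
  by move=> dF i j; have [k [ik jk]] := dF i j; exists k; split; apply: setUS.
have covU (F' : I -> set (formula L C)) G' r :
    covers F' G' -> covers (fun i : I => r |` F' i) (r |` G').
  move=> FG q [->|/FG [i Fq]]; first by exists i0; apply: Hyp; left.
  by exists i; apply: entails_weak Fq _; right.
have dirS F' : directed F' -> directed (fun i : I => @shift L C @` F' i).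
  move=> dF i j; have [k [ik jk]] := dF i j; exists k.
  by split; apply: image_subset.
have covS F' G' : covers F' G' ->
    covers (fun i : I => @shift L C @` F' i) (@shift L C @` G').
  move=> FG _ [q /FG [i Fq] <-]; exists i.
  have := entails_tr (fun j => Var j.+1) Cst Fq; rewrite -substE.
  by under [X in X @` _]funext do rewrite -substE.
move=> dF FG Gp; elim: Gp F dF FG => {G p}.
- by move=> G p Gp F _; apply.
- move=> G p _ IH F dF FG.
  by have [i ?] := IH _ (dirU _ _ dF) (covU _ _ _ FG); exists i; apply: BotC.
- move=> G p q _ IH1 _ IH2 F dF FG.
  have [i Fp] := IH1 F dF FG; have [j Fq] := IH2 F dF FG.
  have [k [ik jk]] := dF i j; exists k.
  by apply: AndI; [apply: entails_weak Fp ik|apply: entails_weak Fq jk].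
- move=> G p q _ IH F dF FG; have [i Fi] := IH F dF FG.
  by exists i; apply: AndEl Fi.
- move=> G p q _ IH F dF FG; have [i Fi] := IH F dF FG.
  by exists i; apply: AndEr Fi.
- move=> G p q _ IH F dF FG; have [i Fi] := IH F dF FG.
  by exists i; apply: OrIl Fi.
- move=> G p q _ IH F dF FG; have [i Fi] := IH F dF FG.
  by exists i; apply: OrIr Fi.
- move=> G p q r _ IH1 _ IH2 _ IH3 F dF FG.
  have [i F1] := IH1 F dF FG.
  have [j F2] := IH2 _ (dirU _ _ dF) (covU _ _ _ FG).
  have [l F3] := IH3 _ (dirU _ _ dF) (covU _ _ _ FG).
  have [m [im jm]] := dF i j; have [k [mk lk]] := dF m l; exists k.
  apply: OrE (entails_weak F1 (subset_trans im mk)) _ _.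
    exact: entails_weak F2 (setUS (subset_trans jm mk)).
  exact: entails_weak F3 (setUS lk).
- move=> G p q _ IH F dF FG.
  by have [i ?] := IH _ (dirU _ _ dF) (covU _ _ _ FG); exists i; apply: ImpI.
- move=> G p q _ IH1 _ IH2 F dF FG.
  have [i Fp] := IH1 F dF FG; have [j Fq] := IH2 F dF FG.
  have [k [ik jk]] := dF i j; exists k.
  exact: ImpE (entails_weak Fp ik) (entails_weak Fq jk).
- move=> G p _ IH F dF FG.
  by have [i ?] := IH _ (dirS _ dF) (covS _ _ FG); exists i; apply: AllI.
- move=> G p t _ IH F dF FG; have [i Fi] := IH F dF FG.
  by exists i; apply: AllE Fi.
- move=> G p t _ IH F dF FG; have [i Fp] := IH F dF FG; exists i.
  exact: ExI Fp.
- move=> G p q _ IH1 _ IH2 F dF FG.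
  have [i Fp] := IH1 F dF FG.
  have [j Fq] := IH2 _ (dirU _ _ (dirS _ dF)) (covU _ _ _ (covS _ _ FG)).
  have [k [ik jk]] := dF i j; exists k.
  apply: ExE (entails_weak Fp ik) (entails_weak Fq _).
  exact/setUS/image_subset.
- by move=> G t F dF FG; exists i0; apply: EqnI.
- move=> G p t u _ IH1 _ IH2 F dF FG.
  have [i Fp] := IH1 F dF FG; have [j Fq] := IH2 F dF FG.
  have [k [ik jk]] := dF i j; exists k.
  exact: EqnE (entails_weak Fp ik) (entails_weak Fq jk).
Qed.

Lemma entails_cut L (C : countType) (F G : set (formula L C)) p :
  (forall q, F q -> entails G q) -> entails F p -> entails G p.
Proof.
move=> FG Fp.
have dG : directed (fun _ : unit => G).
  by move=> i j; exists tt; split=> x.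
by have [|[]//] := entails_directed tt dG _ Fp; move=> q /FG Gq; exists tt.
Qed.

Lemma entails_cut1 L (C : countType) (G : set (formula L C)) p q :
  entails G p -> entails (p |` G) q -> entails G q.
Proof. by move=> Gp; apply: entails_cut => r [->//|]; apply: Hyp. Qed.

(** * Goedel numbers and bounds on constants *)

Local Arguments CodeSeq.code : simpl never.

Lemma term_code_inj L (C : countType) : injective (@term_code L C).
Proof.
elim=> [k|c|f ts IH] [k'|c'|f' ts'] /= /(can_inj CodeSeq.codeK) //.
- by case=> ->.
- by case=> /(pcan_inj pickleK) ->.
case=> /(pcan_inj pickleK) ff'; case: f' / ff' ts' => ts' /eq_in_map E.
by congr App; apply/funext => i; apply/IH/E; rewrite mem_enum.
Qed.

Lemma formula_code_inj L (C : countType) : injective (@formula_code L C).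
Proof.
elim=> [|t u|r ts|p IHp q IHq|p IHp q IHq|p IHp q IHq|p IHp|p IHp]
  [|t' u'|r' ts'|p' q'|p' q'|p' q'|p'|p'] /= /(can_inj CodeSeq.codeK) //.
- by case=> /term_code_inj -> /term_code_inj ->.
- case=> /(pcan_inj pickleK) rr'; case: r' / rr' ts' => ts' /eq_in_map E.
  by congr Atom; apply/funext => i; apply/term_code_inj/E; rewrite mem_enum.
- by case=> /IHp -> /IHq ->.
- by case=> /IHp -> /IHq ->.
- by case=> /IHp -> /IHq ->.
- by case=> /IHp ->.
- by case=> /IHp ->.
Qed.

Lemma term_consts_in_sub L (C : countType) (A B : set C) (t : term L C) :
  A `<=` B -> term_consts_in A t -> term_consts_in B t.
Proof. by move=> AB; elim: t => //= f ts IH ct i; apply: IH. Qed.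

Lemma consts_in_sub L (C : countType) (A B : set C) (p : formula L C) :
  A `<=` B -> consts_in A p -> consts_in B p.
Proof.
move=> AB.
elim: p => //= [t u [ct cu]|r ts ct i|p IHp q IHq|p IHp q IHq|p IHp q IHq].
- by split; apply: term_consts_in_sub AB _.
- exact: term_consts_in_sub AB (ct i).
- by case=> /IHp ? /IHq.
- by case=> /IHp ? /IHq.
- by case=> /IHp ? /IHq.
Qed.

(** Used on the arguments of a function or relation symbol: each has its own
    bound, and the arity is finite. *)
Lemma family_bound n (P : 'I_n -> nat -> Prop) :
  (forall i m m', m <= m' -> P i m -> P i m') ->
  (forall i, exists m, P i m) -> exists m, forall i, P i m.
Proof.
move=> mP /choice [b bP]; exists (\max_i b i) => i.
by apply: mP (bP i); apply: leq_bigmax.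
Qed.

Lemma subset_ord m m' : m <= m' -> `I_m `<=` `I_m'.
Proof. by move=> mm' i /= im; apply: leq_trans mm'. Qed.

Lemma term_consts_bound L (t : term L nat) : exists m, term_consts_in `I_m t.
Proof.
elim: t => [k|c|f ts IH] /=; [by exists 0|by exists c.+1 => /=|].
apply: family_bound IH => i m m' mm'.
exact/term_consts_in_sub/subset_ord.
Qed.

Lemma consts_bound L (p : formula L nat) : exists m, consts_in `I_m p.
Proof.
have bin (P Q : set nat -> Prop) :
    (forall A B, A `<=` B -> P A -> P B) ->
    (forall A B, A `<=` B -> Q A -> Q B) ->
    (exists m, P `I_m) -> (exists m, Q `I_m) -> exists m, P `I_m /\ Q `I_m.
  move=> mP mQ [m Pm] [m' Qm]; exists (maxn m m'); split.
    by apply: mP Pm; apply/subset_ord/leq_maxl.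
  by apply: mQ Qm; apply/subset_ord/leq_maxr.
have mono (q : formula L nat) A B : A `<=` B -> consts_in A q -> consts_in B q.
  exact: consts_in_sub.
elim: p => //= [|t u|r ts|p IHp q IHq|p IHp q IHq|p IHp q IHq].
- by exists 0.
- apply: (bin (fun A => term_consts_in A t) (fun A => term_consts_in A u));
    try exact: term_consts_bound; move=> A B; exact: term_consts_in_sub.
- apply: family_bound => [i m m' mm'|i]; last exact: term_consts_bound.
  exact/term_consts_in_sub/subset_ord.
- exact: bin (mono p) (mono q) IHp IHq.
- exact: bin (mono p) (mono q) IHp IHq.
- exact: bin (mono p) (mono q) IHp IHq.
Qed.

(** * Henkin's construction *)

Lemma bounded_inst L C n (p : formula L C) c :
  bounded n.+1 p -> bounded n (inst p (Cst c)).
Proof.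
rewrite /inst substE => bp.
by apply: (bounded_tr (A := setT)) bp (consts_inT p) => // -[|j].
Qed.

Lemma consts_in_inst L (C : countType) (A : set C) n (p : formula L C) c :
  bounded n p -> consts_in A p -> consts_in (A `|` [set c]) (inst p (Cst c)).
Proof.
rewrite /inst substE => bp.
by apply: consts_in_tr bp => [[|j] _|d Ad] //=; [right|left].
Qed.

(** Translate [c] into the variable 0 and shift the other variables: the
    instance becomes [r] itself and the members of [S], which do not mention
    [c], become their shifts.  This is the side premise of [ExE]. *)
Lemma entails_fresh L (S : set (formula L nat)) (A : set nat) r c :
  (forall p, S p -> sentence p /\ consts_in A p) -> ~ A c -> S (Ex r) ->
  entails (inst r (Cst c) |` S) Bot -> entails S Bot.
Proof.
move=> SA Ac Sr SB; apply: ExE (Hyp Sr) _.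
pose k d : term L nat := if d == c then Var 0 else Cst d.
have kE d : A d -> k d = Cst d by rewrite /k; case: eqP => // ->.
apply: entails_weak (entails_tr (fun j => Var j.+1) k SB) _.
have [br cr] := SA _ Sr.
move=> _ [q [->|Sq] <-]; [left|right; exists q => //].
  rewrite tr_inst /inst substE tr_comp /= /k eqxx -[RHS]tr_id.
  by apply: (eq_tr (n := 1) (A := A)) => // [[]//|d /kE]; rewrite /k => ->.
have [bq cq] := SA _ Sq.
by rewrite /shift substE; apply/esym/(eq_tr (n := 0) (A := A)).
Qed.

(** Codes enumerate the formulas that the construction has to decide; [Bot] is
    a harmless value for numbers that are not codes, since it is refused at
    every stage. *)
Definition decode L (m : nat) : formula L nat :=
  if pselect (exists p : formula L nat, formula_code p = m) is left e
  then sval (cid e) else Bot.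

Lemma formula_codeK L : cancel (@formula_code L nat) (@decode L).
Proof.
move=> p; rewrite /decode; case: pselect => [e|[]]; last by exists p.
by apply: formula_code_inj; apply: (svalP (cid e)).
Qed.

Definition fresh L (S : set (formula L nat)) : nat :=
  xget 0 [set m | forall p, S p -> consts_in `I_m p].

Lemma freshP L (S : set (formula L nat)) :
  (exists m, forall p, S p -> consts_in `I_m p) ->
  forall p, S p -> consts_in `I_(fresh S) p.
Proof. exact: xgetPex. Qed.

(** The fresh constant must avoid [p] as well as [S], hence [fresh (p |` S)]. *)
Definition henkin_add L (S : set (formula L nat)) (p : formula L nat) :=
  if p is Ex r then inst r (Cst (fresh (p |` S))) |` (p |` S) else p |` S.

Fixpoint henkin_stage L (S : set (formula L nat)) (m : nat) :=
  if m is m'.+1 then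
    let S' := henkin_stage S m' in
    if `[< sentence (decode L m') /\ ~ entails (decode L m' |` S') Bot >]
    then henkin_add S' (decode L m') else S'
  else S.

Definition henkin_set L (S : set (formula L nat)) := \bigcup_m henkin_stage S m.

(** The invariant of the construction; the bound on the constants keeps
    witnesses available at every stage. *)
Definition admissible L (S : set (formula L nat)) : Prop :=
  [/\ forall p, S p -> sentence p,
      exists m, forall p, S p -> consts_in `I_m p & ~ entails S Bot].

(** Adding a witness to a consistent set containing [Ex r] is harmless by
    [entails_fresh]; the bound on the constants grows by at most one. *)
Lemma admissible_henkin_add L (S : set (formula L nat)) p :
  admissible S -> sentence p -> ~ entails (p |` S) Bot ->
  admissible (henkin_add S p).
Proof.
move=> [Ss [m Sm] _] sp pS.
have [m' pm'] := consts_bound p.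
have {m m' Sm pm'} [m Sm] : exists m, forall q, (p |` S) q -> consts_in `I_m q.
  exists (maxn m m') => q [->|/Sm].
    by apply: consts_in_sub pm'; apply/subset_ord/leq_maxr.
  by apply/consts_in_sub/subset_ord/leq_maxl.
have {}Ss q : (p |` S) q -> sentence q by case=> [->//|/Ss].
have ad : admissible (p |` S) by split => //; exists m.
rewrite /henkin_add; case: p => // r in sp pS m Sm Ss ad *.
set S' := Ex r |` S in pS Sm Ss ad *; have S'r : S' (Ex r) by left.
have fP : forall q, S' q -> consts_in `I_(fresh S') q.
  by apply: freshP; exists m.
split.
- by move=> q [->|/Ss //]; apply: (bounded_inst (p := r)) sp.
- exists (fresh S').+1 => q [->|/fP]; last exact/consts_in_sub/subset_ord.
  apply: consts_in_sub (consts_in_inst (p := r) _ sp (fP _ S'r)).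
  move=> d [/leqW//|->].
  exact: ltnSn.
- move=> B; apply: pS; apply: (entails_fresh (A := `I_(fresh S'))) S'r B.
    by move=> q S'q; split; [apply: Ss|apply: fP].
  by rewrite /= ltnn.
Qed.

Lemma admissible_henkin_stage L (S : set (formula L nat)) m :
  admissible S -> admissible (henkin_stage S m).
Proof.
move=> adS; elim: m => //= m IH; case: asboolP => // -[sp pS].
exact: admissible_henkin_add.
Qed.

Lemma henkin_add_sub L (S : set (formula L nat)) p :
  p |` S `<=` henkin_add S p.
Proof. by move=> q; case: p => // r Sq; right. Qed.

Lemma henkin_stage_mono L (S : set (formula L nat)) m m' : m <= m' ->
  henkin_stage S m `<=` henkin_stage S m'.
Proof.
move/subnK <-; elim: (m' - m) => //= d IH; case: asboolP => // _.
by apply: subset_trans IH _; apply: subset_trans (@henkin_add_sub _ _ _);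
  apply: subsetUr.
Qed.

Lemma henkin_consistent L (S : set (formula L nat)) :
  admissible S -> ~ entails (henkin_set S) Bot.
Proof.
move=> adS HB.
have [||m] := entails_directed (F := henkin_stage S) 0 _ _ HB.
- move=> m m'; exists (maxn m m').
  by split; apply: henkin_stage_mono; [apply: leq_maxl|apply: leq_maxr].
- by move=> q [m _ Sq]; exists m; apply: Hyp.
- by have [] := admissible_henkin_stage m adS.
Qed.

(** Completeness and witnessing have the same cause: a sentence consistent with
    the whole construction was consistent with the stage at which it was
    examined, so it was accepted there, together with a witness. *)
Lemma henkin_maximal L (S : set (formula L nat)) p :
  sentence p -> ~ entails (p |` henkin_set S) Bot ->
  henkin_set S p /\
  forall r, p = Ex r -> exists c, henkin_set S (inst r (Cst c)).
Proof.
move=> sp pH; set m := formula_code p.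
have E : henkin_stage S m.+1 = henkin_add (henkin_stage S m) p.
  rewrite /= /m formula_codeK; case: asboolP => // -[]; split => // B.
  by apply: pH; apply: entails_weak B _; apply: setUS => q; exists m.
split=> [|r pr].
  by exists m.+1 => //; rewrite E; apply: henkin_add_sub; left.
exists (fresh (p |` henkin_stage S m)), m.+1 => //.
by rewrite E pr; left.
Qed.

Lemma henkin_closed L (S : set (formula L nat)) p : admissible S ->
  sentence p -> entails (henkin_set S) p -> henkin_set S p.
Proof.
move=> adS sp Hp; have [|//] := henkin_maximal (S := S) sp.
by move=> /(entails_cut1 Hp); apply: henkin_consistent.
Qed.

(** Listing [H] by increasing codes exhibits it as a limit of finite sets. *)
Lemma lim_setE L (H : set (formula L nat)) : (forall p, H p -> sentence p) ->
  lim_set (fun n => [set p | H p /\ formula_code p < n]) = H.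
Proof.
move=> Hs; apply/seteqP; split=> p /=.
  by case=> _ [N _ /(_ N (leqnn N))] [].
by move=> Hp; split; [apply: Hs|exists (formula_code p).+1].
Qed.

Lemma model_existence L (T : set (formula L void)) (S : set (formula L nat)) :
  map_formula (of_void nat) @` T `<=` S -> admissible S ->
  exists h, [/\ approximation T h, consistent h & S `<=` lim_set h].
Proof.
move=> TS adS; set H := henkin_set S.
have Hs p : H p -> sentence p.
  by case=> m _; have [+ _ _] := admissible_henkin_stage m adS; apply.
have SH : S `<=` H by move=> p Sp; exists 0.
have HB := henkin_consistent adS.
exists (fun n => [set p | H p /\ formula_code p < n]).
split; rewrite /consistent ?(lim_setE Hs) //; last first.
  by move=> /Hyp.
split; rewrite ?(lim_setE Hs) => //.
- move=> n; apply: (@sub_finite_set _ _ (@formula_code L nat @^-1` `I_n)).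
    by move=> p [].
  apply: finite_preimage; last exact: finite_II.
  by move=> p q _ _; apply: formula_code_inj.
- move=> p; have [Hp|Hp] := pselect (H p).
    by left; exists (formula_code p).+1.
  by right; exists 0 => // n _ [].
- by move=> sigma Ts; apply/SH/TS; exists sigma.
- by move=> p; apply: henkin_closed.
- move=> p sp; have [Hp|Hp] := pselect (H p); [by left|right].
  apply: henkin_closed => //; apply: ImpI; apply: contrapT => pH.
  by apply: Hp; have [] := henkin_maximal sp pH.
- move=> p Hp; have [|_] := henkin_maximal (S := S) (Hs _ Hp).
    by move=> /(entails_cut1 (Hyp Hp)).
  exact.
Qed.

(** * Derived rules *)

Lemma entails_weakU L (C : countType) (G : set (formula L C)) p q :
  entails G q -> entails (p |` G) q.
Proof. by move/entails_weak; apply => r; right. Qed.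

Lemma entails_hyp1 L (C : countType) (G : set (formula L C)) p :
  entails (p |` G) p.
Proof. by apply: Hyp; left. Qed.

Lemma entails_mp1 L (C : countType) (G : set (formula L C)) p q :
  entails G (Imp p q) -> entails (p |` G) q.
Proof. by move=> /(entails_weakU p) /ImpE; apply; apply: entails_hyp1. Qed.

Lemma entails_imp_trans L (C : countType) (G : set (formula L C)) p q r :
  entails G (Imp p q) -> entails G (Imp q r) -> entails G (Imp p r).
Proof.
move=> Gpq Gqr; apply: ImpI.
exact: ImpE (entails_weakU p Gqr) (entails_mp1 Gpq).
Qed.

(** The deductive closures of [q |` G], for [q] in [X], form a directed family
    because [And q r] derives both [q] and [r]; taking closures rather than the
    sets [q |` G] themselves is what makes the inclusions true. *)
Lemma entails_conj L (C : countType) (G X : set (formula L C)) p :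
  entails (G `|` X) p ->
  X (Neg Bot) -> (forall q r, X q -> X r -> X (And q r)) ->
  exists2 q, X q & entails (q |` G) p.
Proof.
move=> Gp X0 XI.
pose F (i : {q | X q}) : set (formula L C) := entails (sval i |` G).
have [||[q Xq] Fp] := entails_directed (F := F) (exist _ _ X0) _ _ Gp.
- move=> [q Xq] [r Xr]; exists (exist _ _ (XI _ _ Xq Xr)).
  have qr := entails_hyp1 G (And q r).
  split=> u; apply: entails_cut => v [->|Gv].
  + exact: AndEl qr.
  + by apply: Hyp; right.
  + exact: AndEr qr.
  + by apply: Hyp; right.
- move=> q [Gq|Xq]; [exists (exist _ _ X0)|exists (exist _ _ Xq)];
    apply: Hyp; apply: Hyp; [by right|by left].
- by exists q => //; apply: entails_cut Fp.
Qed.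

(** * Separation by quantifier-free formulas *)

(** [close] replaces the variable x_i by the constant i, and [open] undoes it.
    They exchange the formulas of L in n variables with the sentences whose
    constants are below n. *)
Definition close L (p : formula L void) : formula L nat :=
  tr Cst (fun c => Cst (of_void nat c)) p.

Definition open L (p : formula L nat) : formula L void := tr Var Var p.

Lemma closeK L : cancel (@close L) (@open L).
Proof.
move=> p; rewrite /open /close tr_comp -[RHS]tr_id.
by congr tr; apply/funext => -[].
Qed.

Lemma entails_open L (G : set (formula L nat)) p :
  entails G p -> entails (@open L @` G) (open p).
Proof. exact: entails_tr. Qed.

Lemma open_map L (p : formula L void) : open (map_formula (of_void nat) p) = p.
Proof.
rewrite /open map_formulaE tr_comp -[RHS]tr_id.
by congr tr; apply/funext => -[].
Qed.

Lemma openK L (p : formula L nat) : sentence p -> close (open p) = p.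
Proof.
move=> sp; rewrite /open /close tr_comp -[RHS]tr_id.
by apply: (eq_tr (n := 0) (A := setT)) => //; apply: consts_inT.
Qed.

Lemma sentence_close L (p : formula L void) n :
  bounded n p -> sentence (close p).
Proof. by move=> bp; apply: bounded_tr bp (consts_inT p). Qed.

Lemma consts_in_close L (p : formula L void) n :
  bounded n p -> consts_in `I_n (close p).
Proof. by move=> bp; apply: consts_in_tr bp (consts_inT p) => // -[]. Qed.

Lemma bounded_open L (p : formula L nat) n :
  sentence p -> consts_in `I_n p -> bounded n (open p).
Proof. exact: bounded_tr. Qed.

Lemma sentence_map L (p : formula L void) (f : void -> nat) :
  sentence p -> sentence (map_formula f p).
Proof.
by rewrite map_formulaE => sp; apply: bounded_tr sp (consts_inT p).
Qed.

Lemma consts_in_map_void L (p : formula L void) (f : void -> nat) A :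
  sentence p -> consts_in A (map_formula f p).
Proof.
by rewrite map_formulaE => sp; apply: consts_in_tr sp (consts_inT p) => // -[].
Qed.

Lemma lim_set_mp L (T : set (formula L void)) h p q : approximation T h ->
  sentence q -> lim_set h (Imp p q) -> lim_set h p -> lim_set h q.
Proof.
move=> Th sq hpq hp; apply: (approx_closed Th) sq _.
exact: ImpE (Hyp hpq) (Hyp hp).
Qed.

(** If [T] and the quantifier-free consequences of [phi] prove [phi], their
    finite conjunction is the equivalent sought.  Otherwise the two Henkin
    theories are built in turn, [h'] first, since the quantifier-free
    sentences imposed on [h] are those true in [h']. *)
Lemma qf_equivalent_or_separated L (T : set (formula L void)) n
    (phi : formula L void) :
  (forall sigma, T sigma -> sentence sigma) -> bounded n phi ->
  (exists psi, [/\ bounded n psi, quantifier_free psi &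
     entails T (Iff phi psi)]) \/
  exists h h', [/\ approximation T h /\ consistent h,
    approximation T h' /\ consistent h', embedding h `I_n id h',
    lim_set h (close phi) & lim_set h' (Neg (close phi))].
Proof.
move=> Ts bphi.
pose X := [set psi | [/\ bounded n psi, quantifier_free psi &
                         entails T (Imp phi psi)]].
have [/entails_conj[||psi [bpsi qpsi phipsi] psiphi]|TX] :=
  pselect (entails (T `|` X) phi).
- by split => //; do 2!apply: ImpI; apply: entails_hyp1.
- move=> q r [bq qq Tq] [br qr Tr]; split=> /=; [by []|by rewrite qq|].
  by apply: ImpI; apply: AndI; apply: entails_mp1.
- by left; exists psi; split => //; apply: AndI => //; apply: ImpI.
right.
have ssphi := sentence_close bphi; have cphi := consts_in_close bphi.
pose T' := map_formula (of_void nat) @` T.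
have T's p : T' p -> sentence p by move=> [q /Ts sq <-]; apply: sentence_map.
have T'c p : T' p -> consts_in `I_n p.
  by move=> [q /Ts sq <-]; apply: consts_in_map_void.
have [||h' [Th' ch' Sh']] := @model_existence L T
    (T' `|` (Neg (close phi) |` (@close L @` X))).
- by move=> p; left.
- split.
  + move=> p [/T's//|[->//|[q [bq _ _] <-]]]; exact: sentence_close bq.
  + exists n => p [/T'c//|[->//|[q [bq _ _] <-]]]; exact: consts_in_close bq.
  + move=> /entails_open B; apply: TX; apply: BotC.
    apply: entails_weak B _ => _ [p [[q Tq <-]|[->|[q Xq <-]]] <-].
    * by right; left; rewrite open_map.
    * by left; apply: (congr1 (@Neg L void) (closeK phi)).
    * by right; right; rewrite closeK.
(* The quantifier-free diagram of 0, ..., n-1 in h'. *)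
pose D := [set d | [/\ sentence d, quantifier_free d, consts_in `I_n d &
                       lim_set h' d]].
have [||h [Th ch Sh]] := @model_existence L T (T' `|` (close phi |` D)).
- by move=> p; left.
- split.
  + by move=> p [/T's//|[->//|[]]].
  + by exists n => p [/T'c//|[->//|[]]].
  + move=> /entails_open B.
    have {}B : entails ((phi |` T) `|` (@open L @` D)) Bot.
      apply: entails_weak B _ => _ [p [[q Tq <-]|[->|Dp]] <-].
      * by left; right; rewrite open_map.
      * by left; left; rewrite closeK.
      * by right; exists p.
    have [||_ [d [sd qd cd h'd] <-] dB] := entails_conj B.
    * exists (Neg Bot) => //; split=> //; apply: (approx_closed Th') => //.
      by apply: ImpI; apply: entails_hyp1.
    * move=> _ _ [d [sd qd cd h'd] <-] [e [se qe ce h'e] <-].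
      exists (And d e) => //; split => //=; first by rewrite qd.
      by apply: (approx_closed Th') => //; apply: AndI; apply: Hyp.
    (* A member d of the diagram refuting phi would put its negation into
       X, which holds in h'. *)
    * have Xd : X (Neg (open d)).
        split=> /=; first by split => //; apply: bounded_open.
          by rewrite quantifier_free_tr qd.
        by do 2!apply: ImpI.
      apply: ch'; apply: lim_set_mp Th' _ _ h'd => //.
      apply: Sh'; right; right; exists (Neg (open d)) => //.
      exact: (congr1 (@Neg L nat) (openK sd)).
exists h, h'; split => //.
- move=> p sp qp cp; rewrite map_formulaE tr_id; split=> [hp|h'p].
    have [//|h'p] := approx_complete Th' sp.
    (* The diagram is complete, so failures in h' also transfer to h. *)
    have hNp : lim_set h (Neg p).
      by apply: Sh; right; right; split=> //=; rewrite qp.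
    by case: ch; apply: lim_set_mp Th _ hNp hp.
  by apply: Sh; right; right.
- by apply: Sh; right; left.
- by apply: Sh'; right; left.
Qed.

Lemma map_formula_inst L (p : formula L nat) (f g : nat -> nat) A a n :
  (forall c, A c -> g c = f c) -> bounded n p -> consts_in A p ->
  map_formula g (inst p (Cst a)) = inst (map_formula f p) (Cst (g a)).
Proof.
move=> fg bp cp; rewrite !map_formulaE tr_inst up_Var /=; congr inst.
by apply: eq_tr bp cp => // c /fg ->.
Qed.

(** * Eliminating quantifiers *)

Definition extension_property L (T : set (formula L void)) : Prop :=
  forall (h h' : nat -> set (formula L nat)) (A : set nat)
      (f : nat -> nat) (a : nat),
    approximation T h -> consistent h ->
    approximation T h' -> consistent h' ->
    embedding h A f h' -> ~ A a ->
    exists (h'' : nat -> set (formula L nat)) (f' g : nat -> nat),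
      [/\ approximation T h'' /\ consistent h'',
          elementary_embedding h' f' h'',
          embedding h (A `|` [set a]) g h''
        & forall n, A n -> g n = f' (f n)].

(** Truth of a quantifier-free instance of [theta] goes up along the extended
    embedding, falsity of [Ex theta] goes up along the elementary one. *)
Lemma qf_equivalent_Ex L (T : set (formula L void)) n theta :
  (forall sigma, T sigma -> sentence sigma) -> extension_property T ->
  quantifier_free theta -> bounded n.+1 theta ->
  exists psi, [/\ bounded n psi, quantifier_free psi &
    entails T (Iff (Ex theta) psi)].
Proof.
move=> Ts ext qtheta btheta.
have [//|[h [h' [[Th ch] [Th' ch'] emb hphi h'phi]]]] :=
  qf_equivalent_or_separated (n := n) (phi := Ex theta) Ts btheta.
have sphi : sentence (close (Ex theta)).
  exact: (sentence_close (p := Ex theta)) btheta.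
have cphi := consts_in_close (p := Ex theta) btheta.
rewrite {1}/close /= in hphi; set chi := tr _ _ theta in hphi.
have bchi : bounded 1 chi := sphi.
have cchi : consts_in `I_n chi := cphi.
have qchi : quantifier_free chi by rewrite quantifier_free_tr.
have [a ha] := approx_witness Th hphi.
have [h'' [f' [g [[Th'' ch''] emb' emb'' gf']]]] :
    exists (h'' : nat -> set (formula L nat)) (f' g : nat -> nat),
      [/\ approximation T h'' /\ consistent h'',
          elementary_embedding h' f' h'',
          embedding h (`I_n `|` [set a]) g h''
        & forall c, `I_n c -> g c = f' c].
  (* When the witness is itself below n, no extension is required. *)
  have [an|an] := pselect (`I_n a); last first.
    by have [h'' [f' [g []]]] := ext _ _ _ _ _ Th ch Th' ch' emb an;
      exists h'', f', g.
  exists h', id, id; split => //.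
    by move=> p _; rewrite map_formulaE tr_id.
  by rewrite setUidl // => _ ->.
case: ch''.
have /emb' : sentence (Neg (close (Ex theta))) by [].
move=> [/(_ h'phi) N _].
apply: (lim_set_mp (p := map_formula f' (close (Ex theta))) Th'' _ N) => //.
apply: (approx_closed Th'').
  rewrite map_formulaE; apply: (bounded_tr (n := 0)) cphi => //.
have -> : map_formula f' (close (Ex theta)) = Ex (map_formula f' chi) by [].
apply: (ExI (t := Cst (g a))); apply: Hyp.
rewrite -(map_formula_inst a gf' bchi cchi); apply/emb'' => //.
- exact: bounded_inst.
- by rewrite /inst substE quantifier_free_tr.
- exact: consts_in_inst bchi cchi.
Qed.

Lemma shift_sentences L (C : countType) (T : set (formula L C)) :
  (forall sigma, T sigma -> sentence sigma) -> @shift L C @` T = T.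
Proof.
move=> Ts.
have E p : T p -> shift p = p.
  move=> /Ts sp; rewrite /shift substE -[RHS]tr_id.
  by apply: (eq_tr (n := 0) (A := setT)) => //; apply: consts_inT.
apply/seteqP; split=> [_ [p Tp <-]|p Tp]; first by rewrite E.
by exists p => //; apply: E.
Qed.

(** Instantiating a shifted quantifier at the variable just freed gives back its
    matrix: the form in which [ExI] and [AllE] are used below. *)
Lemma inst_up_var0 L C (p : formula L C) :
  inst (subst (up (fun j => Var j.+1)) p) (Var 0) = p.
Proof.
rewrite /inst !substE tr_comp -[RHS]tr_id; congr tr.
by apply/funext => -[].
Qed.

Lemma entails_imp_Ex L (C : countType) (T : set (formula L C)) p q :
  @shift L C @` T = T -> entails T (Imp p q) -> entails T (Imp (Ex p) (Ex q)).
Proof.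
move=> sT Tpq; apply: ImpI; apply: ExE (entails_hyp1 _ _) _.
rewrite image_setU image_set1 sT; apply: (ExI (t := Var 0)).
rewrite inst_up_var0; apply: entails_mp1; exact: entails_weakU.
Qed.

Lemma entails_All_not_Ex L (C : countType) (T : set (formula L C)) p q :
  @shift L C @` T = T -> entails T (Imp (Neg p) q) ->
  entails T (Imp (Neg (Ex q)) (All p)).
Proof.
move=> sT Tpq; apply: ImpI; apply: AllI.
rewrite image_setU image_set1 sT; apply: BotC.
apply: ImpE (entails_weakU _ (entails_hyp1 _ _)) _.
apply: (ExI (t := Var 0)); rewrite inst_up_var0.
exact/entails_mp1/entails_weakU.
Qed.

Lemma entails_not_Ex_All L (C : countType) (T : set (formula L C)) p q :
  @shift L C @` T = T -> entails T (Imp q (Neg p)) ->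
  entails T (Imp (All p) (Neg (Ex q))).
Proof.
move=> sT Tpq; do 2!apply: ImpI; apply: ExE (entails_hyp1 _ _) _.
rewrite !image_setU !image_set1 sT.
apply: ImpE (entails_mp1 _) _; first by do 2!apply: entails_weakU; exact: Tpq.
rewrite -[X in entails _ X]inst_up_var0; apply: AllE; apply: Hyp.
by right; right; left.
Qed.

Lemma entails_imp_And L (C : countType) (G : set (formula L C)) p q p' q' :
  entails G (Imp p p') -> entails G (Imp q q') ->
  entails G (Imp (And p q) (And p' q')).
Proof.
move=> Gp Gq; apply: ImpI; have pq := entails_hyp1 G (And p q).
apply: AndI; first exact: ImpE (entails_weakU _ Gp) (AndEl pq).
exact: ImpE (entails_weakU _ Gq) (AndEr pq).
Qed.

Lemma entails_imp_Or L (C : countType) (G : set (formula L C)) p q p' q' :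
  entails G (Imp p p') -> entails G (Imp q q') ->
  entails G (Imp (Or p q) (Or p' q')).
Proof.
move=> Gp Gq; apply: ImpI; apply: OrE (entails_hyp1 _ _) _ _.
  by apply/OrIl/entails_mp1/entails_weakU.
by apply/OrIr/entails_mp1/entails_weakU.
Qed.

Lemma entails_imp_Imp L (C : countType) (G : set (formula L C)) p q p' q' :
  entails G (Imp p' p) -> entails G (Imp q q') ->
  entails G (Imp (Imp p q) (Imp p' q')).
Proof.
move=> Gp Gq; do 2!apply: ImpI.
apply: ImpE (entails_weakU _ (entails_weakU _ Gq)) _.
apply: ImpE (entails_weakU _ (entails_hyp1 _ _)) _.
exact/entails_mp1/entails_weakU.
Qed.

Lemma entails_imp_refl L (C : countType) (G : set (formula L C)) p :
  entails G (Imp p p).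
Proof. by apply: ImpI; apply: entails_hyp1. Qed.

Lemma entails_Alls L (C : countType) (T : set (formula L C)) n p :
  @shift L C @` T = T -> entails T p -> entails T (Alls n p).
Proof.
by move=> sT Tp; elim: n => //= n IH; apply: AllI; rewrite sT.
Qed.

(** The universal quantifier is treated as not-exists-not, so only existential
    quantifiers over quantifier-free matrices are eliminated. *)
Lemma qf_equivalent L (T : set (formula L void)) n phi :
  (forall sigma, T sigma -> sentence sigma) -> extension_property T ->
  bounded n phi ->
  exists psi, [/\ bounded n psi, quantifier_free psi &
    entails T (Iff phi psi)].
Proof.
move=> Ts ext; have sT := shift_sentences Ts.
have atomic m p : bounded m p -> quantifier_free p ->
    exists psi, [/\ bounded m psi, quantifier_free psi & entails T (Iff p psi)].
  by exists p; split => //; apply: AndI; apply: entails_imp_refl.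
elim: phi n => /=.
- by move=> n _; apply: atomic.
- by move=> t u n b; apply: atomic.
- by move=> r ts n b; apply: atomic.
- move=> p IHp q IHq n [/IHp[p' [bp' qp' Tp]] /IHq[q' [bq' qq' Tq]]].
  exists (And p' q'); split=> //=; first by rewrite qp'.
  by apply: AndI; apply: entails_imp_And;
    [apply: AndEl Tp|apply: AndEl Tq|apply: AndEr Tp|apply: AndEr Tq].
- move=> p IHp q IHq n [/IHp[p' [bp' qp' Tp]] /IHq[q' [bq' qq' Tq]]].
  exists (Or p' q'); split=> //=; first by rewrite qp'.
  by apply: AndI; apply: entails_imp_Or;
    [apply: AndEl Tp|apply: AndEl Tq|apply: AndEr Tp|apply: AndEr Tq].
- move=> p IHp q IHq n [/IHp[p' [bp' qp' Tp]] /IHq[q' [bq' qq' Tq]]].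
  exists (Imp p' q'); split=> //=; first by rewrite qp'.
  by apply: AndI; apply: entails_imp_Imp;
    [apply: AndEr Tp|apply: AndEl Tq|apply: AndEl Tp|apply: AndEr Tq].
- move=> p IHp n /IHp[p' [bp' qp' Tp]].
  have [||psi [bpsi qpsi Tpsi]] :=
    qf_equivalent_Ex Ts ext (theta := Neg p') (n := n).
  + by rewrite /= qp'.
  + by [].
  exists (Neg psi); split=> //=; first by rewrite qpsi.
  apply: AndI.
    apply: entails_imp_trans (entails_not_Ex_All sT _) _.
      exact: entails_imp_Imp (AndEl Tp) (entails_imp_refl _ _).
    exact: entails_imp_Imp (AndEr Tpsi) (entails_imp_refl _ _).
  apply: entails_imp_trans (entails_All_not_Ex sT _).
    exact: entails_imp_Imp (AndEl Tpsi) (entails_imp_refl _ _).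
  exact: entails_imp_Imp (AndEr Tp) (entails_imp_refl _ _).
- move=> p IHp n /IHp[p' [bp' qp' Tp]].
  have [psi [bpsi qpsi Tpsi]] := qf_equivalent_Ex Ts ext qp' bp'.
  exists psi; split=> //; apply: AndI.
    exact: entails_imp_trans (entails_imp_Ex sT (AndEl Tp)) (AndEl Tpsi).
  exact: entails_imp_trans (AndEr Tpsi) (entails_imp_Ex sT (AndEr Tp)).
Qed.

Theorem theorem2p3 (L : language) (T : set (formula L void))
  (T_sentences : forall sigma, T sigma -> sentence sigma)
  (T_ce : ce_theory T)
  (T_extension : forall (h h' : nat -> set (formula L nat)) (A : set nat)
      (f : nat -> nat) (a : nat),
    approximation T h -> consistent h ->
    approximation T h' -> consistent h' ->
    embedding h A f h' -> ~ A a ->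
    exists (h'' : nat -> set (formula L nat)) (f' g : nat -> nat),
      [/\ approximation T h'' /\ consistent h'',
          elementary_embedding h' f' h'',
          embedding h (A `|` [set a]) g h''
        & forall n, A n -> g n = f' (f n)]) :
  quantifier_elimination T.
Proof.
move=> n phi /(qf_equivalent T_sentences T_extension)[psi [bpsi qpsi Tpsi]].
by exists psi; split=> //; apply: entails_Alls Tpsi; apply: shift_sentences.
Qed.
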